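(* Let $n\ge m\ge 1$, let $\lambda=(r_1^{i_1},\dots,r_k^{i_k})\in P(m\mid n)$ (so $1\le r_1<\dots<r_k$, $i_s\ge1$) and let $\mu=(\mu_1,\dots,\mu_n)\in P(m\mid n)$. Then $$K^{-1}_{\lambda,\mu}=\sum_{j:\ r_j-\mu_n\ge 0}(-1)^{r_j-\mu_n}\sum_{\omega:\ \mu^{(n)}-\omega\in\{r_j-\mu_n\}}K^{-1}_{\lambda[j],\omega},$$ where $\mu^{(n)}=(\mu_1,\dots,\mu_{n-1})$ and the inner sum runs over partitions $\omega=(\omega_1,\dots,\omega_{n-1})$. Consequently, $K^{-1}_{\lambda,\mu}=\sum_{S\in S(\lambda,\mu)}\mathrm{sign}(S)$.
   Context: A partition in $P(m\mid n)$ is a sequence $(\lambda_1,\dots,\lambda_n)$ of non-negative integers with $\lambda_1\le\dots\le\lambda_n$ summing to $m$; a shorter nondecreasing sequence denotes the partition obtained by prepending zeros. $\lambda=(r_1^{i_1},\dots,r_k^{i_k})$ denotes the partition consisting of zeros followed by $i_1$ copies of $r_1$, ..., $i_k$ copies of $r_k$; its length is $l(\lambda)=\sum i_s$ (number of nonzero parts). $\lambda[j]$ is the partition obtained from $\lambda$ by removing one part equal to $r_j$. For partitions $\alpha,\beta$ with the same number of entries, $\alpha-\beta\in\{r\}$ means each $\alpha_i-\beta_i\in\{0,1\}$ and exactly $r$ indices have $\alpha_i-\beta_i=1$; and $\beta<_r\alpha$ means $\alpha^{(n)}-\beta\in\{r\}$ where $\alpha^{(n)}=(\alpha_1,\dots,\alpha_{n-1})$.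 Monomial symmetric functions: $m_\lambda(n)=\sum x^{\alpha}$ over the distinct rearrangements $\alpha\in\mathbb{N}^n$ of $\lambda$; Schur functions: $s_\lambda(n)=\det(x_j^{\lambda_i+i-1})/\det(x_j^{i-1})$. The integers $K^{-1}_{\lambda,\nu}$ are defined by $m_\lambda(n)=\sum_{\nu\in P(m\mid n)}K^{-1}_{\lambda,\nu}s_\nu(n)$; they do not depend on the number $n\ge m$ of variables (partitions being identified up to leading zeros), which is how $K^{-1}_{\lambda[j],\omega}$ is understood. Writing $\lambda=\{\lambda_1,\dots,\lambda_k\}$ for the list of its nonzero parts ($k=l(\lambda)$), $S(\lambda,\mu)$ is the set of chains of partitions $(0)=\mu^0<_{j_1}\mu^1<_{j_2}\cdots<_{j_k}\mu^k=\mu$ (each $\mu^i$ an $n$-tuple partition) such that, writing $\mu^i_n$ for the last entry of $\mu^i$ and $b_i=\mu^i_n+j_i$, the sequence $(b_1,\dots,b_k)$ is a permutation of $(\lambda_1,\dots,\lambda_k)$; for such $S$, $\mathrm{sign}(S)=(-1)^{j_1+\dots+j_k}$. *)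

(* Defs.v *)
From Stdlib Require Import ClassicalEpsilon.
From HB Require Import structures.
From mathcomp Require Import all_boot all_order all_algebra fraction.
From mathcomp.multinomials Require Import mpoly.

Set Implicit Arguments.
Unset Strict Implicit.
Unset Printing Implicit Defensive.

Import GRing.Theory.
Local Open Scope ring_scope.

Fixpoint words (T : Type) (l : nat) (A : seq T) : seq (seq T) :=
  if l is l'.+1 then [seq x :: w | x <- A, w <- words l' A] else [:: [::]].

Lemma mem_words (T : eqType) l (A w : seq T) :
  (w \in words l A) = (size w == l) && all (fun x => x \in A) w.
Proof.
elim: l w => [|l IH] [|x w] //=.
  by apply/allpairsP => -[[y v] []].
rewrite eqSS; apply/allpairsP/idP => [[[y v] /= [Ay + [-> ->]]]|].
  by rewrite IH => /andP[-> ->]; rewrite Ay.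
by case/and3P => sw Ax Aw; exists (x, w); split; rewrite //= IH sw.
Qed.

Lemma words_uniq (T : eqType) l (A : seq T) : uniq A -> uniq (words l A).
Proof.
move=> uA; elim: l => [|l IH] //=.
by apply: allpairs_uniq => // -[x v] [y w] _ _ [-> ->].
Qed.

(* Partitions are nondecreasing sequences, padded with zeros on the left. *)
Definition is_tpart (n : nat) (a : seq nat) : bool :=
  (size a == n) && sorted leq a.

Definition is_part (m n : nat) (a : seq nat) : bool :=
  is_tpart n a && (sumn a == m).

(* Enumeration of P(m | n), see [mem_Parts] and [Parts_uniq]. *)
Definition Parts (m n : nat) : seq (seq nat) :=
  [seq a <- words n (iota 0 m.+1) | is_part m n a].

Lemma leq_mem_sumn (a : seq nat) x : x \in a -> (x <= sumn a)%N.
Proof.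
elim: a => //= y a IH; rewrite inE => /predU1P[->|/IH]; first exact: leq_addr.
by move/leq_trans; apply; exact: leq_addl.
Qed.

Lemma mem_Parts m n a : (a \in Parts m n) = is_part m n a.
Proof.
rewrite mem_filter; case: (boolP (is_part m n a)) => //= /andP[/andP[sa _]].
move=> /eqP sum_a; rewrite mem_words sa /=; apply/allP => x /leq_mem_sumn.
by rewrite sum_a -[_ :: _]/(iota 0 m.+1) mem_iota add0n ltnS.
Qed.

Lemma Parts_uniq m n : uniq (Parts m n).
Proof. by apply: filter_uniq; apply: words_uniq; exact: iota_uniq. Qed.

(* The n-entry partition (r_1^{i_1}, ..., r_k^{i_k}). *)
Definition exp_part (n k : nat) (r i : 'I_k -> nat) : seq nat :=
  nseq (n - \sum_(s < k) i s) 0%N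
    ++ flatten [seq nseq (i s) (r s) | s <- enum 'I_k].

Definition nzparts (a : seq nat) : seq nat := [seq x <- a | x != 0%N].

Definition trunc (a : seq nat) : seq nat := take (size a).-1 a.

(* alpha - beta \in {r}; [all2] forces equal sizes. *)
Definition diff_in (r : nat) (a b : seq nat) : bool :=
  all2 (fun x y => (x == y) || (x == y.+1)) a b
  && (count (fun p => p.1 == p.2.+1) (zip a b) == r).

(* beta <_r alpha for alpha, beta with the same number of entries: the
   shorter sequence trunc alpha is padded with a leading zero. *)
Definition prec (r : nat) (b a : seq nat) : bool := diff_in r (0%N :: trunc a) b.

Definition mnm_of_seq (n : nat) (a : seq nat) : 'X_{1..n} :=
  [multinom nth 0%N a i | i < n].

(* [permutations lam] lists the distinct rearrangements without repetition. *)
Definition msymf (n : nat) (lam : seq nat) : {mpoly int[n]} :=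
  \sum_(a <- permutations lam) 'X_[mnm_of_seq n a].

(* Rows are indexed from 0, so the exponent lam_i + i - 1 becomes lam_i + i. *)
Definition altdet (n : nat) (lam : seq nat) : {mpoly int[n]} :=
  \det (\matrix_(i < n, j < n) ('X_j : {mpoly int[n]}) ^+ (nth 0%N lam i + i)).

Definition vdm (n : nat) : {mpoly int[n]} :=
  \det (\matrix_(i < n, j < n) ('X_j : {mpoly int[n]}) ^+ i).

Definition schur (n : nat) (lam : seq nat) : {fraction {mpoly int[n]}} :=
  tofrac (altdet n lam) / tofrac (vdm n).

Definition is_Kinv (K : seq nat -> seq nat -> int) : Prop :=
  [/\ forall lam nu, K (0%N :: lam) nu = K lam nu,
      forall lam nu, K lam (0%N :: nu) = K lam nu
    & forall m n lam, (m <= n)%N -> is_part m n lam ->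
        tofrac (msymf n lam) = \sum_(nu <- Parts m n) schur n nu *~ K lam nu].

(* [is_Kinv] determines K lam nu whenever lam and nu are partitions of the
   same integer, since Schur functions are linearly independent; [epsilon]
   selects such a K. *)
Definition Kinv : seq nat -> seq nat -> int :=
  epsilon (inhabits (fun _ _ => 0)) is_Kinv.

(* S = ([:: mu^0; ...; mu^l], [:: j_1; ...; j_l]) with l = l(lam); hence
   j_(i+1) is entry i of S.2. *)
Definition is_chain (n : nat) (lam mu : seq nat)
    (S : seq (seq nat) * seq nat) : bool :=
  let l := size (nzparts lam) in
  [&& size S.1 == l.+1, size S.2 == l,
      all (is_tpart n) S.1,
      nth [::] S.1 0 == nseq n 0%N,
      nth [::] S.1 l == mu,
      all (fun i => prec (nth 0%N S.2 i) (nth [::] S.1 i) (nth [::] S.1 i.+1))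
          (iota 0 l)
    & perm_eq [seq (last 0 (nth [::] S.1 i.+1) + nth 0 S.2 i)%N | i <- iota 0 l]
              (nzparts lam)].

(* Enumeration of S(lam, mu), see [mem_chains] and [chains_uniq]; all entries
   of the mu^i are bounded by |mu|, and each j_i is at most n. *)
Definition chains (n : nat) (lam mu : seq nat) : seq (seq (seq nat) * seq nat) :=
  let l := size (nzparts lam) in
  [seq S <- [seq (c, js) | c <- words l.+1 (words n (iota 0 (sumn mu).+1)),
                           js <- words l (iota 0 n.+1)]
         | is_chain n lam mu S].

Lemma chains_uniq n lam mu : uniq (chains n lam mu).
Proof.
apply: filter_uniq; apply: allpairs_uniq => [||[x v] [y w] _ _ [-> ->]] //;
  do ?apply: words_uniq; exact: iota_uniq.
Qed.

Lemma diff_in_le r a b B :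
  diff_in r a b -> all (geq B) a -> all (geq B) b.
Proof.
case/andP => + _; elim: a b => [|x a IH] [|y b] //= /andP[xy ab] /andP[xB aB].
rewrite (IH _ ab aB) andbT.
by case/orP: xy => /eqP xy; move: xB; rewrite xy //= => /ltnW.
Qed.

Lemma prec_le r a b B : prec r b a -> all (geq B) a -> all (geq B) b.
Proof.
move=> /diff_in_le ba aB; apply: ba; rewrite /= /trunc.
by apply/allP => x /mem_take xa; exact: (allP aB).
Qed.

Lemma mem_chains n lam mu S : (S \in chains n lam mu) = is_chain n lam mu S.
Proof.
rewrite mem_filter; case: (boolP (is_chain n lam mu S)) => //.
rewrite andTb; case: S => c js; rewrite /is_chain; set l := size (nzparts lam).
case/and5P; rewrite ![(c, js).1]/= ![(c, js).2]/=.
move=> /eqP sc /eqP sj /allP tc _ /and3P[/eqP cl /allP pc _].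
have tn i : (i <= l)%N -> size (nth [::] c i) = n.
  by rewrite -ltnS -sc => il; have /andP[/eqP] := tc _ (mem_nth [::] il).
have bd d : (d <= l)%N -> all (geq (sumn mu)) (nth [::] c (l - d)).
  elim: d => [|d IH] dl.
    by rewrite subn0 cl; apply/allP => x /leq_mem_sumn.
  apply: (prec_le (r := nth 0%N js (l - d.+1)) _ (IH (ltnW dl))).
  have -> : (l - d = (l - d.+1).+1)%N by rewrite subnSK.
  by apply: pc; rewrite mem_iota add0n /= ltn_subrL /= (leq_trans _ dl).
apply: (allpairs_f (fun c js => (c, js))).
  rewrite mem_words sc eqxx /=.
  apply/(all_nthP [::]) => i; rewrite sc ltnS => il.
  rewrite mem_words tn // eqxx /=; apply/allP => x xi.
  have := bd (l - i)%N (leq_subr _ _); rewrite subKn // => /allP /(_ _ xi) /=.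
  by rewrite -[_ :: _]/(iota 0 (sumn mu).+1) mem_iota add0n ltnS.
rewrite mem_words sj eqxx /=; apply/(all_nthP 0%N) => i; rewrite sj => il.
rewrite -[_ :: _]/(iota 0 n.+1) mem_iota add0n ltnS /=.
have : prec (nth 0%N js i) (nth [::] c i) (nth [::] c i.+1).
  by apply: pc; rewrite mem_iota.
case/andP => _ /eqP <-; apply: leq_trans (count_size _ _) _.
by rewrite size_zip (tn i (ltnW il)) geq_minr.
Qed.

(* Main.v *)
Require Import Defs.
From Stdlib Require Import ClassicalEpsilon.
From HB Require Import structures.
From mathcomp Require Import all_boot all_order all_fingroup all_algebra fraction.
From mathcomp Require Import zify.
From mathcomp.multinomials Require Import mpoly.

(** Multiplying [m_lambda] by the Vandermonde determinant and reading off the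
    coefficient of [x^(nu + delta)] shows that [K^-1_(lambda, nu)] is the sum of
    [sign s] over the permutations [s] for which [(nu_i + i - s(i))_i] is a
    rearrangement of [lambda]; prepending a zero to both partitions forces
    [s(0) = 0], which gives the independence of [n].  Formally this sum is the
    coefficient of [y_lambda] in the determinant of [y_(nu_i + i - j)], with
    [y_k = 0] for [k < 0]. Expanding it along the last row, where
    [s(n-1) = n-1-j] contributes the part [mu_n + j] and the sign [(-1)^j],
    leaves a determinant whose last [j] columns are shifted by one.  It equals
    the sum over all [j]-subsets of shifted columns, because any other subset
    produces two equal columns; summing over permutations this is also the sum
    over all [j]-subsets of shifted rows, in which the subsets that do not give
    a partition [omega] vanish because two rows coincide or the first row is
    zero. Iterating the recurrence gives the sum over chains. *)

Set Implicit Arguments.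
Unset Strict Implicit.
Unset Printing Implicit Defensive.

Import GRing.Theory Num.Theory.
Local Open Scope ring_scope.

(** * Signed counts of permutations *)

(** Says that [s] contributes the monomial [y_lam] to the determinant with entries [y_(f i - g j)].
    The inequality keeps the truncated subtraction exact, in accordance with [y_k = 0] for
    [k < 0]. *)
Definition fits n (lam : seq nat) (f g : 'I_n -> nat) (s : 'S_n) : bool :=
  [forall i, (g (s i) <= f i)%N]
  && perm_eq lam [seq (f i - g (s i))%N | i <- enum 'I_n].

(** Row values [f] and column values [g] are arbitrary, so that minors and matrices with shifted
    rows or columns keep this form. *)
Definition altcount n (lam : seq nat) (f g : 'I_n -> nat) : int :=
  \sum_(s : 'S_n | fits lam f g s) (-1) ^+ s.

Definition Kdet n (lam nu : seq nat) : int :=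
  @altcount n lam (fun i => nth 0 nu i + i)%N (fun j => j : nat).

Lemma perm_map_perm n (T : eqType) (F : 'I_n -> T) (t : 'S_n) :
  perm_eq [seq F (t i) | i <- enum 'I_n] [seq F i | i <- enum 'I_n].
Proof.
have -> : [seq F (t i) | i <- enum 'I_n] = map F (map t (enum 'I_n)).
  by elim: (enum 'I_n) => //= x l ->.
apply: perm_map; apply: uniq_perm.
- by rewrite map_inj_uniq ?enum_uniq //; exact: perm_inj.
- exact: enum_uniq.
move=> i; rewrite mem_enum; apply/mapP; exists ((t^-1)%g i); rewrite ?mem_enum //.
by rewrite permKV.
Qed.

Lemma eq_fits n lam (f g f' g' : 'I_n -> nat) (s s' : 'S_n) :
    (forall i, (g (s i) <= f i)%N = (g' (s' i) <= f' i)%N) ->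
    (forall i, f i - g (s i) = f' i - g' (s' i))%N ->
  fits lam f g s = fits lam f' g' s'.
Proof.
move=> h1 h2; rewrite /fits; congr (_ && _); first by apply: eq_forallb => i; rewrite h1.
by congr (perm_eq _ _); apply: eq_map.
Qed.

Lemma eq_altcount n lam (f g f' g' : 'I_n -> nat) :
  f =1 f' -> g =1 g' -> altcount lam f g = altcount lam f' g'.
Proof. by move=> h1 h2; apply: eq_bigl => s; apply: eq_fits => i; rewrite h1 h2. Qed.

(** Reindexing along the sign-reversing involution [phi] shows that the sum equals its own
    opposite. *)
Lemma signed_sum_eq0 n (P : pred 'S_n) (phi : 'S_n -> 'S_n) :
    involutive phi -> (forall s, phi s = ~~ s :> bool) ->
    (forall s, P (phi s) = P s) ->
  \sum_(s : 'S_n | P s) (-1) ^+ s = 0 :> int.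
Proof.
move=> phiK phi_odd phiP; apply/eqP; rewrite -eqNr.
rewrite [X in _ == X](reindex_inj (inv_inj phiK)) /= (eq_bigl _ _ phiP) -sumrN.
by apply/eqP; apply: eq_bigr => s _; rewrite phi_odd signrN.
Qed.

(** Multiplying by the transposition on the left exchanges the images of [i] and [j]; as the two row
    values agree, this only permutes the list of differences. *)
Lemma altcount_eqrow n lam (f g : 'I_n -> nat) (i j : 'I_n) :
  i != j -> f i = f j -> altcount lam f g = 0.
Proof.
move=> ij fij; apply: (signed_sum_eq0 (phi := fun s => tperm i j * s)%g).
- by move=> s; rewrite mulgA tperm2 mul1g.
- by move=> s; rewrite odd_mul_tperm ij.
move=> s; have fE k : f (tperm i j k) = f k by case: tpermP => // ->.
rewrite /fits; congr (_ && _).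
  apply/forallP/forallP => h k; have := h (tperm i j k);
  by rewrite fE permM ?tpermK // -?permM mulgA ?tperm2 ?mul1g.
rewrite -(permPr (perm_map_perm (fun k => f k - g (s k))%N (tperm i j))).
by congr (perm_eq _ _); apply: eq_map => k; rewrite permM fE.
Qed.

(** Here the transposition acts on the right, that is, on the images of [s], and no difference
    changes. *)
Lemma altcount_eqcol n lam (f g : 'I_n -> nat) (i j : 'I_n) :
  i != j -> g i = g j -> altcount lam f g = 0.
Proof.
move=> ij gij; apply: (signed_sum_eq0 (phi := fun s => s * tperm i j)%g).
- by move=> s; rewrite -mulgA tperm2 mulg1.
- by move=> s; rewrite odd_permM odd_tperm ij addbT.
by move=> s; apply: eq_fits => k; rewrite permM; case: tpermP => // ->; rewrite ?gij.
Qed.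

(** [lift_perm i j] is a bijection from the permutations of [n] points onto those of [n.+1] points
    that send [i] to [j]. *)
Lemma sum_lift_perm n (i j : 'I_n.+1) (P : pred 'S_n.+1) (F : 'S_n.+1 -> int) :
  \sum_(s | P s && (s i == j)) F s =
  \sum_(t : 'S_n | P (lift_perm i j t)) F (lift_perm i j t).
Proof.
(* The preimage of [s] is the map that it induces from the complement of [i] to the complement of
   [j]. *)
have surj (s : 'S_n.+1) : s i = j -> exists t, lift_perm i j t = s.
  move=> sij; have sl k : s (lift i k) != j.
    by rewrite -sij (inj_eq perm_inj) eq_sym neq_lift.
  have h k : {l | s (lift i k) = lift j l}.
    by case: (unliftP j (s (lift i k))) => [l|] e; [exists l | case/eqP: (sl k)].
  have inj : injective (fun k => sval (h k)).
    move=> k l; case: (h k) => x /= hx; case: (h l) => y /= hy xy.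
    by apply: (@lift_inj _ i); apply: (@perm_inj _ s); rewrite hx hy xy.
  exists (perm inj); apply/permP => k; case: (unliftP i k) => [l|] ->.
    by rewrite lift_perm_lift permE; case: (h l) => x /= ->.
  by rewrite lift_perm_id.
have inj : injective (@lift_perm n i j).
  move=> t u /permP e; apply/permP => k; apply: (@lift_inj _ j).
  by rewrite -(lift_perm_lift i j t) -(lift_perm_lift i j u) e.
pose A := [set t | P (lift_perm i j t)].
transitivity (\sum_(t in A) F (lift_perm i j t)); last first.
  by apply: eq_bigl => t; rewrite inE.
rewrite -(big_imset F (in2W inj)) /=.
apply: eq_bigl => s; apply/andP/imsetP => [[Ps /eqP/surj[t ts]]|[t + ->]].
  by exists t; rewrite // inE ts.
by rewrite inE lift_perm_id eqxx.
Qed.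

Lemma perm_eq_rem (T : eqType) (x : T) (s t : seq T) :
  perm_eq s (x :: t) = (x \in s) && perm_eq (rem x s) t.
Proof.
case: (boolP (x \in s)) => /= [xs|].
  by rewrite (permPl (perm_to_rem xs)) perm_cons.
by apply: contraNF => /perm_mem ->; rewrite mem_head.
Qed.

Lemma forall_lift n (i : 'I_n.+1) (P : pred 'I_n.+1) :
  [forall k, P k] = P i && [forall k, P (lift i k)].
Proof.
apply/forallP/andP => [h|[hi /forallP h] k].
  by split=> //; apply/forallP => k.
by case: (unliftP i k) => [l|] ->.
Qed.

Lemma perm_enum_lift n (i : 'I_n.+1) (T : eqType) (F : 'I_n.+1 -> T) :
  perm_eq [seq F k | k <- enum 'I_n.+1] (F i :: [seq F (lift i k) | k <- enum 'I_n]).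
Proof.
have -> : F i :: [seq F (lift i k) | k <- enum 'I_n]
        = map F (i :: [seq lift i k | k <- enum 'I_n]).
  by rewrite /=; congr (_ :: _); elim: (enum 'I_n) => //= x l ->.
apply: perm_map; apply: uniq_perm; rewrite ?enum_uniq //=.
  rewrite map_inj_uniq ?enum_uniq ?andbT; last exact: lift_inj.
  by apply/mapP => -[k _ /eqP]; rewrite (negPf (neq_lift i k)).
move=> k; rewrite mem_enum in_cons; case: (unliftP i k) => [l|] ->; last by rewrite eqxx.
by rewrite map_f ?orbT // mem_enum.
Qed.

(** Row [i] uses up one part [f i - g j] of [lam]; the other rows have to produce the remaining
    parts. *)
Lemma fits_lift n lam (f g : 'I_n.+1 -> nat) (i j : 'I_n.+1) (t : 'S_n) :
  fits lam f g (lift_perm i j t) =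
  [&& (g j <= f i)%N, (f i - g j)%N \in lam
    & fits (rem (f i - g j)%N lam) (fun k => f (lift i k)) (fun k => g (lift j k)) t].
Proof.
rewrite /fits (forall_lift i) lift_perm_id.
rewrite (permPr (perm_enum_lift i _)) lift_perm_id perm_eq_rem.
have -> : [forall k, g (lift_perm i j t (lift i k)) <= f (lift i k)]%N
        = [forall k, g (lift j (t k)) <= f (lift i k)]%N.
  by apply: eq_forallb => k; rewrite lift_perm_lift.
have -> : [seq f (lift i k) - g (lift_perm i j t (lift i k)) | k <- enum 'I_n]%N
        = [seq f (lift i k) - g (lift j (t k)) | k <- enum 'I_n]%N.
  by apply: eq_map => k; rewrite lift_perm_lift.
by rewrite -!andbA; congr (_ && _); rewrite andbCA.
Qed.

(** Laplace expansion along row [i]: the permutations are grouped by the column [s i]. *)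
Lemma altcount_expand n lam (f g : 'I_n.+1 -> nat) (i : 'I_n.+1) :
  altcount lam f g =
  \sum_(j < n.+1 | (g j <= f i)%N && ((f i - g j)%N \in lam))
    (-1) ^+ (i + j) *
    altcount (rem (f i - g j)%N lam) (fun k => f (lift i k)) (fun k => g (lift j k)).
Proof.
rewrite /altcount (partition_big (fun s : 'S_n.+1 => s i) xpredT) //=.
rewrite [RHS]big_mkcond; apply: eq_bigr => j _.
rewrite sum_lift_perm; case: ifP => [/andP[h1 h2]|h].
  rewrite big_distrr /=; apply: eq_big => t; first by rewrite fits_lift h1 h2.
  by move=> _; rewrite odd_lift_perm -oddD signr_addb signr_odd.
by rewrite big1 // => t; rewrite fits_lift andbA h.
Qed.

Lemma Kdet_cons0 n lam nu : Kdet n.+1 (0%N :: lam) (0%N :: nu) = Kdet n lam nu.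
Proof.
(* The first row has value 0, so only column 0 can be used there. *)
rewrite /Kdet (altcount_expand _ _ _ ord0) (big_pred1 ord0) /=; last first.
  move=> j; rewrite /= addn0 leqn0 -val_eqE /=.
  by case: eqP => //= ->; rewrite mem_head.
rewrite mul1r; apply: eq_bigl => s; apply: eq_fits => k; rewrite /= /bump /=.
  by rewrite addnCA leq_add2l.
by rewrite addnCA subnDl.
Qed.

(** * Shifted rows and columns *)

Lemma card_ord_geq n p : #|[set q : 'I_n | (p <= q)%N]| = (n - p)%N.
Proof.
rewrite -sum1dep_card -(big_mkord (fun q => p <= q)%N (fun=> 1%N)).
by rewrite -(big_nat_widenl p 0 n xpredT (fun=> 1%N)) // sum_nat_const_nat muln1.
Qed.

(** A set closed under successor is a final segment, hence determined by its cardinality: it either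
    lies in the segment from [p] on, or has an element below [p] and contains that segment. *)
Lemma up_closed_eq n (J : {set 'I_n}) p :
    (forall q q' : 'I_n, q' = q.+1 :> nat -> q \in J -> q' \in J) ->
  #|J| = (n - p)%N -> J = [set q : 'I_n | (p <= q)%N].
Proof.
move=> upJ cJ.
have upJd d (x y : 'I_n) : y = (x + d)%N :> nat -> x \in J -> y \in J.
  elim: d y => [|d IH] y hy xJ.
    by rewrite (_ : y = x) //; apply: ord_inj; rewrite hy addn0.
  have lt : (x + d < n)%N by have := ltn_ord y; rewrite hy; lia.
  by apply: (upJ (Ordinal lt)); [rewrite /= hy addnS | exact: IH].
case: (boolP (J \subset [set q : 'I_n | (p <= q)%N])) => [sub|].
  by apply/eqP; rewrite eqEcard sub card_ord_geq cJ leqnn.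
case/subsetPn => x xJ; rewrite inE -ltnNge => xp.
apply/esym/eqP; rewrite eqEcard card_ord_geq cJ leqnn andbT.
apply/subsetP => y; rewrite inE => py.
by apply: (upJd (y - x)%N x) => //; lia.
Qed.

(* If J is not the set of the last n - p columns, two consecutive columns coincide. *)
Lemma altcount_bump n lam (f : 'I_n -> nat) p :
  altcount lam f (fun q => bump p q) =
  \sum_(J : {set 'I_n} | #|J| == (n - p)%N)
    altcount lam f (fun q => q + (q \in J))%N.
Proof.
rewrite (bigD1 [set q : 'I_n | (p <= q)%N]) ?card_ord_geq //= big1 ?addr0.
  by apply: eq_altcount => // q; rewrite inE /bump addnC.
move=> J /andP[/eqP cJ /eqP nJ].
have [/existsP[q /existsP[q' /and3P[/eqP qq' qJ q'J]]]|/existsPn h] :=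
  boolP [exists q : 'I_n, exists q' : 'I_n,
           [&& q' == q.+1 :> nat, q \in J & q' \notin J]].
  apply: (@altcount_eqcol _ _ _ _ q q'); last by rewrite qJ (negPf q'J) qq'; lia.
  by apply/eqP => e; rewrite e in qq'; lia.
case: nJ; apply: up_closed_eq => // q q' qq' qJ.
by have /existsPn/(_ q') := h q; rewrite qq' eqxx qJ /= negbK.
Qed.

(** For fixed [s] the sets of columns are the images under [s] of the sets of rows. Instead of
    lowering the rows in [I], which could truncate, all columns and the rows outside [I] are raised
    by one. *)
Lemma altcount_cols_rows n lam (f : 'I_n -> nat) j :
  \sum_(J : {set 'I_n} | #|J| == j) altcount lam f (fun q => q + (q \in J))%N =
  \sum_(I : {set 'I_n} | #|I| == j)
    altcount lam (fun i => f i + (i \notin I))%N (fun q => q.+1).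
Proof.
rewrite /altcount.
rewrite (exchange_big_dep xpredT) //= [RHS](exchange_big_dep xpredT) //=.
apply: eq_bigr => s _.
rewrite (reindex_inj (imset_inj (@perm_inj _ s))) /=.
apply: eq_bigl => I; rewrite card_imset; last exact: perm_inj.
congr (_ && _); apply: eq_fits => i; rewrite mem_imset; try exact: perm_inj;
  case: (i \in I) => /=; lia.
Qed.

Lemma sumn_nth n (a : seq nat) : size a = n -> sumn a = \sum_(i < n) nth 0%N a i.
Proof. by move=> <-; rewrite sumnE (big_nth 0%N) big_mkord. Qed.

Lemma diff_inP n r (a b : seq nat) : size a = n ->
  diff_in r a b <->
  [/\ size b = n,
      forall i : 'I_n, nth 0%N a i = (nth 0%N b i + (nth 0%N a i == (nth 0%N b i).+1))%N
    & #|[set i : 'I_n | nth 0%N a i == (nth 0%N b i).+1]| = r].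
Proof.
move=> sa; rewrite /diff_in all2E sa.
have cE : size b = n -> count (fun p : nat * nat => p.1 == p.2.+1) (zip a b)
        = #|[set i : 'I_n | nth 0%N a i == (nth 0%N b i).+1]|.
  move=> sb; rewrite -sum1_count (big_nth (0, 0)%N) size_zip sa sb minnn big_mkord.
  rewrite -sum1dep_card; apply: eq_bigl => i.
  by rewrite nth_zip ?sa.
split.
  case/andP => /andP[/eqP/esym sb /allP h] /eqP c; split=> //; last by rewrite -cE.
  move=> i; have := h (nth (0, 0)%N (zip a b) i).
  rewrite mem_nth ?size_zip ?sa ?sb ?minnn ?ltn_ord // nth_zip ?sa //= => /(_ isT).
  by case/orP => /eqP ->; lia.
case=> sb h c; rewrite sb eqxx cE // c eqxx andbT /=.
apply/(all_nthP (0, 0)%N) => i; rewrite size_zip sa sb minnn => ilt.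
have := h (Ordinal ilt); rewrite nth_zip ?sa //=.
by case: eqP => //; lia.
Qed.

Definition subset_sub n (mu : seq nat) (I : {set 'I_n}) : seq nat :=
  [seq nth 0 mu i - (i \in I) | i : 'I_n <- enum 'I_n]%N.

Lemma size_subset_sub n mu (I : {set 'I_n}) : size (subset_sub mu I) = n.
Proof. by rewrite size_map size_enum_ord. Qed.

Lemma nth_subset_sub n mu (I : {set 'I_n}) (i : 'I_n) :
  nth 0%N (subset_sub mu I) i = (nth 0 mu i - (i \in I))%N.
Proof. by rewrite (nth_map i) ?size_enum_ord // nth_ord_enum. Qed.

(** The first clause excludes truncation in [subset_sub], the second asks that the result be a
    partition. *)
Definition admissible n (mu : seq nat) (I : {set 'I_n}) : bool :=
  [forall i : 'I_n, (i \in I) <= nth 0 mu i]%N && sorted leq (subset_sub mu I).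

Lemma altcount_admissible n lam mu (I : {set 'I_n}) : admissible mu I ->
  altcount lam (fun i => nth 0 mu i + i + (i \notin I))%N (fun q => q.+1) =
  Kdet n lam (subset_sub mu I).
Proof.
case/andP => /forallP h _; apply: eq_bigl => s.
by apply: eq_fits => i; rewrite nth_subset_sub; have := h i; case: (i \in I) => /=; lia.
Qed.

(** If two consecutive parts are equal and only the later one is lowered, their rows coincide.
    Otherwise some zero part is lowered, which forces the first row to vanish. *)
Lemma altcount_inadmissible n lam mu (I : {set 'I_n}) :
    is_tpart n mu -> ~~ admissible mu I ->
  altcount lam (fun i => nth 0 mu i + i + (i \notin I))%N (fun q => q.+1) = 0.
Proof.
case/andP => /eqP smu /(sortedP 0%N); rewrite smu => mu_sorted.
have [/existsP[q /existsP[q' /and4P[/eqP qq' /eqP e qI q'I]]]|/existsPn h0] :=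
  boolP [exists q : 'I_n, exists q' : 'I_n,
           [&& q' == q.+1 :> nat, nth 0%N mu q == nth 0%N mu q', q \notin I & q' \in I]].
  move=> _; apply: (@altcount_eqrow _ _ _ _ q q').
    by apply/eqP => e'; rewrite e' in qq'; lia.
  by rewrite e q'I qI qq' /=; lia.
have h (q q' : 'I_n) : q' = q.+1 :> nat -> nth 0%N mu q = nth 0%N mu q' ->
    q' \in I -> q \in I.
  move=> qq' e q'I; have /existsPn/(_ q') := h0 q.
  by rewrite qq' eqxx -[in nth 0%N mu q.+1]qq' e eqxx q'I andbT /= negbK.
(* By [h] the order cannot break: lowering an entry by one matters only if its left neighbour is
   equal and is not lowered. *)
rewrite negb_and orbC; case/orP => [/negP[]|].
  apply/(sortedP 0%N) => i; rewrite size_subset_sub => ilt.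
  have ilt' := ltnW ilt; have := mu_sorted i ilt.
  rewrite (nth_subset_sub _ _ (Ordinal ilt)) (nth_subset_sub _ _ (Ordinal ilt')) /=.
  have := h (Ordinal ilt') (Ordinal ilt) erefl; rewrite /= => hh le.
  case: (boolP (Ordinal ilt \in I)) hh => // _ hh; last lia.
  have [e|] := eqVneq (nth 0%N mu i) (nth 0%N mu i.+1); first by rewrite hh // e.
  by move: le; case: (_ \in I); lia.
case/forallPn => i; rewrite -ltnNge => hi.
have {hi} [iI mui] : i \in I /\ nth 0%N mu i = 0%N.
  by move: hi; case: (i \in I) => //=; lia.
(* The parts before a zero part are zero as well, so [h] carries membership in [I] down to index
   0. *)
have desc d (k : 'I_n) : i = (k + d)%N :> nat -> k \in I /\ nth 0%N mu k = 0%N.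
  elim: d k => [|d IH] k ik.
    by rewrite (_ : k = i) //; apply: ord_inj; rewrite ik addn0.
  have lt : (k.+1 < n)%N by have := ltn_ord i; rewrite ik; lia.
  have [] := IH (Ordinal lt); first by rewrite ik /=; lia.
  move=> kI mk; have := mu_sorted _ lt; rewrite -[nth 0%N mu k.+1]/(nth 0%N mu (Ordinal lt)).
  rewrite mk leqn0 => /eqP mk0; split=> //.
  by apply: (h k (Ordinal lt)) => //; rewrite mk0 mk.
have npos : (0 < n)%N by have := ltn_ord i; lia.
have [kI mk] := desc i (Ordinal npos) erefl.
(* Row 0 has value 0 while every column has value at least 1, so no permutation fits. *)
rewrite /altcount big_pred0 // => s; apply/negP => /andP[/forallP/(_ (Ordinal npos))].
by rewrite kI mk.
Qed.

Lemma sumn_subset_sub n mu (I : {set 'I_n}) : size mu = n ->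
  [forall i : 'I_n, (i \in I) <= nth 0 mu i]%N -> (sumn (subset_sub mu I) + #|I| = sumn mu)%N.
Proof.
move=> smu /forallP h; rewrite (sumn_nth (size_subset_sub mu I)) (sumn_nth smu).
rewrite -sum1_card [X in (_ + X)%N]big_mkcond -big_split /=.
apply: eq_bigr => i _; rewrite nth_subset_sub; have := h i.
by case: (i \in I) => /=; lia.
Qed.

(** Lowering the parts indexed by [I] is a bijection from the admissible [j]-subsets onto the
    partitions [w] of the right-hand side. *)
Lemma sum_subsets_Parts n lam mu j : is_tpart n mu -> (j <= sumn mu)%N ->
  \sum_(I : {set 'I_n} | #|I| == j)
    altcount lam (fun i => nth 0 mu i + i + (i \notin I))%N (fun q => q.+1) =
  \sum_(w <- Parts (sumn mu - j) n | diff_in j mu w) Kdet n lam w.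
Proof.
move=> mu_part j_le; have /andP[/eqP smu _] := mu_part.
rewrite (bigID (@admissible n mu)) /= [X in _ + X]big1 ?addr0; last first.
  by move=> I /andP[_]; exact: altcount_inadmissible.
transitivity (\sum_(I : {set 'I_n} | (#|I| == j) && admissible mu I)
                Kdet n lam (subset_sub mu I)).
  by apply: eq_bigr => I /andP[_]; exact: altcount_admissible.
rewrite -[LHS]big_filter -(big_map (subset_sub mu) xpredT (Kdet n lam)).
rewrite -[RHS]big_filter; apply: perm_big; apply: uniq_perm.
- rewrite map_inj_in_uniq ?filter_uniq ?index_enum_uniq // => I J.
  rewrite !mem_filter => /andP[/and3P[_ /forallP hI _] _] /andP[/and3P[_ /forallP hJ _] _].
  move=> e; apply/setP => i; have := nth_subset_sub mu I i.
  rewrite e nth_subset_sub; have := hI i; have := hJ i.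
  by case: (i \in I); case: (i \in J) => //=; lia.
- by rewrite filter_uniq // Parts_uniq.
move=> w; rewrite mem_filter mem_Parts.
apply/mapP/andP => [[I + ->]|[/(diff_inP _ _ smu)[sw hw cw] /andP[/andP[_ w_sorted] /eqP sum_w]]].
  rewrite mem_filter => /andP[/andP[/eqP cI /andP[hI sI]] _].
  have sumE := sumn_subset_sub smu hI; move/forallP: hI => hI.
  have eqI (i : 'I_n) : (nth 0 mu i == (nth 0 (subset_sub mu I) i).+1)%N = (i \in I).
    by rewrite nth_subset_sub; have := hI i; case: (i \in I) => /=; lia.
  split; last first.
    rewrite /is_part /is_tpart size_subset_sub eqxx sI /=; apply/eqP; lia.
  apply/(diff_inP _ _ smu); split; first exact: size_subset_sub.
    by move=> i; rewrite eqI nth_subset_sub subnK.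
  by rewrite -cI; apply: eq_card => i; rewrite inE eqI.
(* The inverse map records the positions at which [mu] and [w] differ. *)
pose I := [set i : 'I_n | nth 0%N mu i == (nth 0%N w i).+1].
have wE : w = subset_sub mu I.
  apply: (@eq_from_nth _ 0%N); rewrite sw ?size_subset_sub // => i ilt.
  have := hw (Ordinal ilt); rewrite (nth_subset_sub _ _ (Ordinal ilt)) inE /=; lia.
exists I => //; rewrite mem_filter mem_index_enum cw eqxx /= andbT.
rewrite /admissible -wE w_sorted andbT; apply/forallP => i.
by rewrite inE; case: eqP => // ->.
Qed.

(** * Recurrence from the expansion along the last row *)

(** Passes from column offsets [j] to distinct parts [r = l + j]; the parts with [r - l] beyond the
    last column contribute 0. *)
Lemma sum_shift_undup (lam : seq nat) l n (G : nat -> int) :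
    (forall j, (n < j)%N -> G j = 0) ->
  \sum_(j < n.+1 | (l + j)%N \in lam) G j =
  \sum_(r <- undup lam | (l <= r)%N) G (r - l)%N.
Proof.
move=> G0; rewrite (bigID (fun r => r - l <= n)%N) /= [X in _ + X]big1; last first.
  by move=> r /andP[_]; rewrite -ltnNge; exact: G0.
rewrite addr0 -(big_mkord (fun j => l + j \in lam)%N G) -big_filter -[RHS]big_filter.
rewrite -(big_map (fun r => r - l)%N xpredT G).
apply: perm_big; apply: uniq_perm.
- by rewrite filter_uniq // iota_uniq.
- rewrite map_inj_in_uniq ?filter_uniq ?undup_uniq // => x y.
  by rewrite !mem_filter => /andP[/andP[h _] _] /andP[/andP[h' _] _]; lia.
move=> j; rewrite mem_filter mem_index_iota /=; apply/andP/mapP => [[jl jn]|[r + ->]].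
  by exists (l + j)%N; rewrite ?addKn // mem_filter mem_undup jl leq_addr addKn -ltnS jn.
by rewrite mem_filter mem_undup => /andP[/andP[h h'] rl]; rewrite subnKC // ltnS.
Qed.

Lemma last_trunc (mu : seq nat) n : size mu = n.+1 ->
  mu = rcons (trunc mu) (last 0%N mu) /\ size (trunc mu) = n.
Proof.
case/lastP: mu => // s x; rewrite size_rcons => -[<-].
by rewrite /trunc size_rcons last_rcons /= -cats1 take_size_cat // cats1.
Qed.

Lemma Kdet_rec n m lam mu : is_part m n.+1 mu -> sumn lam = m ->
  Kdet n.+1 lam mu =
  \sum_(r <- undup lam | (last 0 mu <= r)%N)
    (-1) ^+ (r - last 0 mu)%N *
    \sum_(w <- Parts (m - r) n | diff_in (r - last 0 mu)%N (trunc mu) w)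
      Kdet n (rem r lam) w.
Proof.
case/andP => /andP[/eqP smu mu_sorted] /eqP sum_mu sum_lam.
have [muE st] := last_trunc smu.
set l := last 0%N mu in muE *; set t := trunc mu in muE st *.
have t_part : is_tpart n t.
  by rewrite /is_tpart st eqxx /t /trunc; exact: take_sorted.
have sum_t : m = (sumn t + l)%N by rewrite -sum_mu muE sumn_rcons.
pose G j := (-1) ^+ j * \sum_(w <- Parts (m - (l + j)) n | diff_in j t w)
      Kdet n (rem (l + j)%N lam) w.
transitivity (\sum_(r <- undup lam | (l <= r)%N) G (r - l)%N); last first.
  by apply: eq_bigr => r lr; rewrite /G subnKC.
rewrite -(@sum_shift_undup _ _ n); last first.
  (* At most [n] entries of [trunc mu] can be lowered. *)
  move=> j nj; rewrite /G big_pred0 ?mulr0 // => w; apply/negP.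
  case/(diff_inP _ _ st) => _ _ c; move: nj; rewrite -c ltnNge => /negP[].
  by rewrite -[X in (_ <= X)%N]card_ord max_card.
(* Column [j] of the last row yields the part [l + (n - j)], so the offset is reversed to match the
   column index. *)
rewrite (reindex_inj rev_ord_inj) /= /Kdet (altcount_expand _ _ _ ord_max) /=.
have nth_t (k : nat) : (k < n)%N -> nth 0%N mu k = nth 0%N t k.
  by rewrite muE nth_rcons st => ->.
have nth_l : nth 0%N mu n = l by rewrite muE nth_rcons st ltnn eqxx.
rewrite nth_l; apply: eq_big => j.
  have jn : (j <= n)%N by rewrite -ltnS.
  by rewrite subSS addnBA // andb_idl // => _; lia.
have jn : (j <= n)%N by rewrite -ltnS.
rewrite subSS -addnBA // => /andP[_ r_in].
rewrite /G; congr (_ * _); first by rewrite -signr_odd oddD -oddB // signr_odd.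
have le : (n - j <= sumn t)%N.
  by have := leq_mem_sumn r_in; rewrite sum_lam sum_t; lia.
have -> : (m - (l + (n - j)) = sumn t - (n - j))%N by lia.
(* Read backwards, the three lemmas lead to the minor without column [j], whose columns are
   [bump j]. *)
rewrite -sum_subsets_Parts // -altcount_cols_rows -altcount_bump.
apply: eq_altcount => k //=.
by rewrite /bump leqNgt ltn_ord add0n nth_t.
Qed.

(** * Alternating polynomials *)

Definition dexp n (nu : seq nat) : 'X_{1..n} := [multinom (nth 0 nu i + i)%N | i < n].

Lemma altdetE n lam :
  altdet n lam =
  \sum_(s : 'S_n) (-1) ^+ s *: 'X_[[multinom (nth 0 lam (s i) + s i)%N | i < n]].
Proof.
(* After transposition [s] acts on the exponents and the variables stay in order, so each product is
   a monomial. *)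
rewrite /altdet -det_tr; apply: eq_bigr => s _.
rewrite mulr_sign scaler_sign [in RHS]mpolyXE_id.
have -> : \prod_(i < n) ((\matrix_(i, j) ('X_j : {mpoly int[n]}) ^+ (nth 0 lam i + i))^T)%N i (s i)
        = \prod_(i < n) 'X_i ^+ [multinom (nth 0 lam (s i) + s i)%N | i < n] i.
  by apply: eq_bigr => i _; rewrite !mxE mnmE.
by [].
Qed.

Lemma vdmE n : vdm n = altdet n (nseq n 0%N).
Proof.
by congr (\det _); apply/matrixP => i j; rewrite !mxE nth_nseq ltn_ord.
Qed.

Definition alternating n (p : {mpoly int[n]}) : Prop :=
  forall s : 'S_n, msym s p = (-1) ^+ s *: p.

Lemma alternating_altdet n lam : alternating (altdet n lam).
Proof.
move=> s; rewrite altdetE raddf_sum scaler_sumr /= (reindex_inj (mulgI s)) /=.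
apply: eq_bigr => t _; rewrite msymZ msymX scalerA odd_permM signr_addb.
congr (_ *: 'X_[_]); apply/mnmP => i; rewrite !mnmE permM.
by rewrite permKV.
Qed.

Definition act n (s : 'S_n) (a : seq nat) : seq nat :=
  [seq nth 0%N a (s i) | i <- enum 'I_n].

Lemma size_act n (s : 'S_n) a : size (act s a) = n.
Proof. by rewrite size_map size_enum_ord. Qed.

Lemma nth_act n (s : 'S_n) a (i : 'I_n) : nth 0%N (act s a) i = nth 0%N a (s i).
Proof. by rewrite (nth_map i) ?size_enum_ord // nth_ord_enum. Qed.

Lemma actK n (s : 'S_n) a : size a = n -> act (s^-1)%g (act s a) = a.
Proof.
move=> sa; apply: (@eq_from_nth _ 0%N); rewrite size_act ?sa // => i ilt.
by rewrite (nth_act _ _ (Ordinal ilt)) nth_act permKV.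
Qed.

Lemma perm_act n (s : 'S_n) a : size a = n -> perm_eq (act s a) a.
Proof.
move=> sa; apply: (perm_trans (perm_map_perm (fun i : 'I_n => nth 0%N a i) s)).
suff -> : [seq nth 0%N a i | i : 'I_n <- enum 'I_n] = a by [].
apply: (@eq_from_nth _ 0%N); rewrite size_map size_enum_ord ?sa // => i ilt.
by rewrite (nth_map (Ordinal ilt)) ?size_enum_ord // nth_enum_ord.
Qed.

(** [msym s] sends the monomial of [a] to that of [act s^-1 a], and [act] permutes the
    rearrangements of [lam]. *)
Lemma symmetric_msymf n lam (s : 'S_n) : size lam = n -> msym s (msymf n lam) = msymf n lam.
Proof.
move=> sl; rewrite /msymf raddf_sum /=.
transitivity (\sum_(a <- permutations lam) 'X_[mnm_of_seq n (act (s^-1)%g a)] : {mpoly int[n]}).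
  apply: eq_bigr => a _; rewrite msymX; congr 'X_[_]; apply/mnmP => i.
  by rewrite !mnmE nth_act.
rewrite -(big_map (act (s^-1)%g) xpredT (fun a => 'X_[mnm_of_seq n a])).
have szp a : a \in permutations lam -> size a = n.
  by rewrite mem_permutations => /perm_size ->.
apply: perm_big; apply: uniq_perm; rewrite ?permutations_uniq //.
  rewrite map_inj_in_uniq ?permutations_uniq // => a b /szp sa /szp sb e.
  by rewrite -(actK (s^-1)%g sa) e actK.
move=> a; apply/mapP/idP => [[b bl ->]|al].
  rewrite mem_permutations (permPl (perm_act _ (szp _ bl))).
  by rewrite -mem_permutations.
exists (act s a); last by rewrite actK ?szp.
by rewrite mem_permutations (permPl (perm_act _ (szp _ al))) -mem_permutations.
Qed.

Lemma alternating_msymf_vdm n lam : size lam = n -> alternating (msymf n lam * vdm n).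
Proof.
move=> sl s; rewrite msymM symmetric_msymf // vdmE alternating_altdet.
by rewrite scalerAr.
Qed.

Lemma alternating_sum n (r : seq (seq nat)) (c : seq nat -> int) :
  alternating (\sum_(nu <- r) altdet n nu *~ c nu).
Proof.
move=> s; rewrite raddf_sum scaler_sumr /=; apply: eq_bigr => nu _.
by rewrite raddfMz /= alternating_altdet scalerMzr.
Qed.

(** A strictly increasing sequence satisfies [w_i >= i], so subtracting the staircase is exact and
    leaves a nondecreasing sequence. *)
Lemma sorted_ltn_sub_index (w : seq nat) n : size w = n -> sorted ltn w ->
  exists2 nu, is_tpart n nu & forall i : 'I_n, nth 0%N w i = (nth 0%N nu i + i)%N.
Proof.
move=> sw /(sortedP 0%N); rewrite sw => h.
have ge i : (i < n)%N -> (i <= nth 0%N w i)%N.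
  elim: i => // i IH ilt; apply: leq_ltn_trans (h _ ilt); exact: IH (ltnW ilt).
exists (mkseq (fun i => nth 0 w i - i)%N n).
  rewrite /is_tpart size_mkseq eqxx /=; apply/(sortedP 0%N) => i.
  by rewrite size_mkseq => ilt; rewrite !nth_mkseq ?(ltnW ilt) //; have := h _ ilt; lia.
by move=> i; rewrite nth_mkseq // subnK ?ge.
Qed.

(* A monomial with a repeated exponent has coefficient 0, any other can be
   permuted to a strictly increasing one. *)
Lemma alternating_ext n (p q : {mpoly int[n]}) :
    alternating p -> alternating q ->
    (forall nu, is_tpart n nu -> p@_(dexp n nu) = q@_(dexp n nu)) ->
  p = q.
Proof.
move=> alt_p alt_q eq_pq; apply/mpolyP => u.
have coefE (s : 'S_n) r : alternating r ->
    r@_[multinom u (s i) | i < n] = (-1) ^+ s * r@_u.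
  by move=> alt_r; rewrite -mcoeff_sym alt_r mcoeffZ.
have [/existsP[i /existsP[j /andP[ij /eqP uij]]]|/existsPn inj0] :=
  boolP [exists i : 'I_n, exists j : 'I_n, (i != j) && (u i == u j)].
  have z r : alternating r -> r@_u = 0.
    move=> /(coefE (tperm i j)) e; apply/eqP; rewrite -eqNr; apply/eqP.
    move: e; rewrite odd_tperm ij expr1 mulN1r => <-.
    by congr (_@_ _); apply/mnmP => k; rewrite mnmE; case: tpermP => // ->.
  by rewrite !z.
have u_inj : injective u.
  move=> i j uij; apply/eqP; have /existsPn/(_ j) := inj0 i.
  by rewrite uij eqxx andbT negbK.
pose t : n.-tuple nat := [tuple u i | i < n].
have /tuple_permP[s es] : perm_eq (sort leq t) t by rewrite perm_sort.
have [||nu nu_part nuE] := @sorted_ltn_sub_index (sort leq t) n.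
- by rewrite size_sort size_tuple.
- rewrite ltn_sorted_uniq_leq sort_uniq sort_sorted ?andbT; last exact: leq_total.
  by rewrite map_inj_uniq ?enum_uniq.
have e : dexp n nu = [multinom u (s i) | i < n].
  apply/mnmP => i; rewrite !mnmE -nuE es.
  by rewrite -tnth_nth !tnth_mktuple.
have := eq_pq _ nu_part; rewrite e !coefE //.
by move/(congr1 (fun x => (-1) ^+ s * x)); rewrite !signrMK.
Qed.

(** For each term [s] of the Vandermonde determinant exactly one exponent, [a0], can complete it to
    [nu + delta]; it occurs, and once, precisely when it is a rearrangement of [lam]. *)
Lemma mcoeff_msymf_vdm n lam nu : size lam = n ->
  (msymf n lam * vdm n)@_(dexp n nu) = Kdet n lam nu.
Proof.
move=> sl; rewrite vdmE altdetE mulr_sumr raddf_sum /= /Kdet /altcount [RHS]big_mkcond.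
apply: eq_bigr => s _; rewrite -scalerAr mcoeffZ /msymf mulr_suml raddf_sum /=.
set a0 := [seq (nth 0 nu i + i - s i)%N | i : 'I_n <- enum 'I_n].
have a0_nth (i : 'I_n) : nth 0%N a0 i = (nth 0 nu i + i - s i)%N.
  by rewrite (nth_map i) ?size_enum_ord // nth_ord_enum.
have size_a0 : size a0 = n by rewrite size_map size_enum_ord.
have termE a : a \in permutations lam ->
    ('X_[mnm_of_seq n a] * 'X_[[multinom (nth 0 (nseq n 0) (s i) + s i)%N | i < n]]
       : {mpoly int[n]})@_(dexp n nu)
    = ([forall i : 'I_n, s i <= nth 0 nu i + i]%N && (a == a0))%:R.
  rewrite mem_permutations => /perm_size; rewrite sl => sa.
  rewrite -mpolyXD mcoeffX; congr (nat_of_bool _)%:R.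
  apply/eqP/andP => [/mnmP e|[/forallP h /eqP ->]].
    have {}e (i : 'I_n) : (nth 0 a i + s i = nth 0 nu i + i)%N.
      by have := e i; rewrite !mnmE nth_nseq ltn_ord.
    split; first by apply/forallP => i; rewrite -e leq_addl.
    apply/eqP; apply: (@eq_from_nth _ 0%N); rewrite ?size_a0 // sa => i ilt.
    by rewrite (a0_nth (Ordinal ilt)) -e /= addnK.
  by apply/mnmP => i; rewrite !mnmE nth_nseq ltn_ord a0_nth subnK.
rewrite big_seq (eq_bigr _ termE) -big_seq /fits -/a0.
case: (boolP [forall i : 'I_n, _]) => _ /=; last by rewrite big1 ?mulr0.
rewrite perm_sym -mem_permutations; case: ifP => a0_in.
  rewrite (bigD1_seq a0) ?permutations_uniq //= eqxx big1 ?addr0 ?mulr1 //.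
  by move=> a /negPf ->.
rewrite big_seq big1 ?mulr0 // => a al; case: eqP => // e.
by rewrite -e al in a0_in.
Qed.

Lemma is_tpart_nth n nu i j : is_tpart n nu -> (i <= j < n)%N ->
  (nth 0 nu i <= nth 0 nu j)%N.
Proof.
case/andP => /eqP sn nu_sorted /andP[ij jn].
apply: (sorted_leq_nth leq_trans leqnn) => //; rewrite inE sn //.
exact: leq_ltn_trans jn.
Qed.

(** Since [nu + delta] is strictly increasing, only the identity yields an increasing exponent. *)
Lemma mcoeff_altdet n nu nu' : is_tpart n nu -> is_tpart n nu' ->
  (altdet n nu)@_(dexp n nu') = (nu == nu')%:R.
Proof.
move=> hnu hnu'; rewrite altdetE raddf_sum /=.
have [snu snu'] : size nu = n /\ size nu' = n.
  by case/andP: hnu => /eqP + _; case/andP: hnu' => /eqP.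
pose L a := mkseq (fun i => nth 0 a i + i)%N n.
have L_sorted a : is_tpart n a -> sorted leq (L a).
  move=> ha; apply/(sortedP 0%N) => i; rewrite size_mkseq => ilt.
  rewrite !nth_mkseq ?(ltnW ilt) //; have := @is_tpart_nth n a i i.+1 ha; lia.
have termE (s : 'S_n) :
    ([multinom (nth 0 nu (s i) + s i)%N | i < n] == dexp n nu') = (s == 1%g) && (nu == nu').
  apply/eqP/andP => [/mnmP e|[/eqP -> /eqP ->]]; last first.
    by apply/mnmP => i; rewrite !mnmE perm1.
  have {}e (i : 'I_n) : (nth 0 nu (s i) + s i = nth 0 nu' i + i)%N.
    by have := e i; rewrite !mnmE.
  have actL : act s (L nu) = L nu'.
    apply: (@eq_from_nth _ 0%N); rewrite size_act ?size_mkseq // => i ilt.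
    by rewrite (nth_act _ _ (Ordinal ilt)) !nth_mkseq ?e.
  (* Two sorted lists that are rearrangements of each other are equal. *)
  have LL : L nu = L nu'.
    apply: (sorted_eq leq_trans anti_leq); rewrite ?L_sorted //.
    by rewrite perm_sym -actL perm_act // size_mkseq.
  have nuE : nu = nu'.
    apply: (@eq_from_nth _ 0%N); rewrite ?snu' // snu => i ilt.
    have := congr1 (fun l => nth 0%N l i) LL; rewrite !nth_mkseq //; lia.
  split; last exact/eqP.
  (* As [nu] is nondecreasing, [nu_(s i) + s i = nu_i + i] forces [s i = i]. *)
  apply/eqP/permP => i; rewrite perm1; apply: ord_inj.
  have := e i; rewrite -nuE; have := ltn_ord i; have := ltn_ord (s i).
  have := @is_tpart_nth n nu i (s i) hnu; have := @is_tpart_nth n nu (s i) i hnu; lia.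
rewrite (bigD1 1%g) //= odd_perm1 expr0 scale1r mcoeffX termE eqxx big1 ?addr0 //.
by move=> s s1; rewrite mcoeffZ mcoeffX termE (negPf s1) mulr0.
Qed.

Lemma vdm_neq0 n : vdm n != 0.
Proof.
have h : is_tpart n (nseq n 0%N).
  rewrite /is_tpart size_nseq eqxx /=; apply/(sortedP 0%N) => i _.
  by rewrite !nth_nseq; do 2 case: ifP.
apply/eqP => e; have := mcoeff_altdet h h.
by rewrite -vdmE e mcoeff0 eqxx.
Qed.

(** Coordinates with respect to the alternants are coefficients at the exponents [nu + delta]; this
    yields both the existence and the uniqueness of the expansion. *)
Lemma mcoeff_sum_altdet m n (c : seq nat -> int) nu : is_tpart n nu ->
  (\sum_(w <- Parts m n) altdet n w *~ c w)@_(dexp n nu) =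
  (if sumn nu == m then c nu else 0).
Proof.
move=> hnu; rewrite raddf_sum /=.
have termE w : w \in Parts m n ->
    (altdet n w *~ c w)@_(dexp n nu) = if w == nu then c nu else 0.
  rewrite mem_Parts => /andP[hw _]; rewrite raddfMz /= mcoeff_altdet //.
  by case: eqP => [->|_]; rewrite ?mul0rz // -mulrzr mul1r intz.
rewrite big_seq (eq_bigr _ termE) -big_seq.
have mE : (sumn nu == m) = (nu \in Parts m n) by rewrite mem_Parts /is_part hnu.
rewrite mE; case: ifP => nu_in.
  rewrite (bigD1_seq nu) ?Parts_uniq //= eqxx big1 ?addr0 //.
  by move=> w /negPf ->.
rewrite big_seq big1 // => w w_in; case: eqP => // e.
by rewrite -e w_in in nu_in.
Qed.

(** In the sum of the differences [nu_i + i - s i] the indices cancel. *)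
Lemma fits_sumn n lam nu (s : 'S_n) : size nu = n ->
  fits lam (fun i => nth 0 nu i + i)%N (fun j => j : nat) s -> sumn lam = sumn nu.
Proof.
move=> sn /andP[/forallP h /perm_sumn ->].
rewrite sumnE big_map big_enum /= (sumn_nth sn).
apply: (@addIn (\sum_(i < n) i)%N).
rewrite [X in (_ + X)%N = _](reindex_inj (@perm_inj _ s)) -!big_split /=.
by apply: eq_bigr => i _; rewrite subnK.
Qed.

Lemma Kdet_sumn_neq n lam nu : size nu = n -> sumn nu != sumn lam -> Kdet n lam nu = 0.
Proof.
move=> sn ne; rewrite /Kdet /altcount big_pred0 // => s; apply/negP => /(fits_sumn sn) e.
by rewrite e eqxx in ne.
Qed.

Lemma msymf_vdm_expand m n lam : size lam = n -> sumn lam = m ->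
  msymf n lam * vdm n = \sum_(nu <- Parts m n) altdet n nu *~ Kdet n lam nu.
Proof.
move=> sl suml; apply: alternating_ext; first exact: alternating_msymf_vdm.
  exact: alternating_sum.
move=> nu hnu; rewrite mcoeff_msymf_vdm // mcoeff_sum_altdet //.
case: ifP => // /negbT ne; apply: Kdet_sumn_neq; last by rewrite suml.
by case/andP: hnu => /eqP.
Qed.

(** Clears the common denominator [vdm n], which is nonzero. *)
Lemma schur_expansionP m n lam (c : seq nat -> int) :
  tofrac (msymf n lam) = \sum_(nu <- Parts m n) schur n nu *~ c nu <->
  msymf n lam * vdm n = \sum_(nu <- Parts m n) altdet n nu *~ c nu.
Proof.
have v0 : tofrac (vdm n) != 0 by rewrite tofrac_eq0 vdm_neq0.
have -> : \sum_(nu <- Parts m n) schur n nu *~ c nu =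
          tofrac (\sum_(nu <- Parts m n) altdet n nu *~ c nu) / tofrac (vdm n).
  rewrite rmorph_sum mulr_suml; apply: eq_bigr => nu _.
  by rewrite rmorphMz /schur mulrzAl.
split=> [e|<-]; last by rewrite rmorphM /= mulfK.
by apply/eqP; rewrite -tofrac_eq rmorphM /= e divfK.
Qed.

(** * Identification of the inverse Kostka numbers *)

Fixpoint strip (a : seq nat) : seq nat := if a is 0%N :: a' then strip a' else a.

Definition pad N (a : seq nat) : seq nat := nseq (N - size a) 0%N ++ a.

Lemma stripK a : nseq (size a - size (strip a)) 0%N ++ strip a = a.
Proof.
have h b : (size (strip b) <= size b)%N by elim: b => [|[|x] b IH] //=; exact: leqW.
by elim: a => [|[|x] a IH] /=; rewrite ?subnn // subSn //= IH.
Qed.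

Lemma size_strip a : (size (strip a) <= size a)%N.
Proof. by rewrite -[in X in (_ <= X)%N](stripK a) size_cat leq_addl. Qed.

Lemma pad_strip N a : (size (strip a) <= N <= size a)%N ->
  a = nseq (size a - N) 0%N ++ pad N (strip a).
Proof.
move=> h; rewrite /pad catA -nseqD -[LHS]stripK; congr (nseq _ _ ++ _); lia.
Qed.

Lemma Kdet_nseq d n lam nu :
  Kdet (d + n) (nseq d 0%N ++ lam) (nseq d 0%N ++ nu) = Kdet n lam nu.
Proof. by elim: d => //= d IH; rewrite addSn Kdet_cons0. Qed.

(** [is_Kinv] asks for one function on all sequences, insensitive to leading zeros. Stripping the
    zeros and padding to a common length provides it. *)
Definition Kstab (lam nu : seq nat) : int :=
  let N := maxn (size (strip lam)) (size (strip nu)) in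
  Kdet N (pad N (strip lam)) (pad N (strip nu)).

Lemma KstabE n lam nu : size lam = n -> size nu = n -> Kstab lam nu = Kdet n lam nu.
Proof.
move=> sl sn; rewrite /Kstab; set N := maxn _ _.
have Nn : (N <= n)%N by rewrite geq_max -{1}sl -sn !size_strip.
rewrite [in RHS](@pad_strip N lam) ?sl ?Nn ?leq_maxl //.
rewrite [in RHS](@pad_strip N nu) ?sn ?Nn ?leq_maxr //.
by rewrite -[in RHS](subnK Nn) addnK Kdet_nseq.
Qed.

Lemma is_Kinv_Kstab : is_Kinv Kstab.
Proof.
split=> // m n lam _ /andP[/andP[/eqP sl _] /eqP suml].
apply/schur_expansionP; rewrite (msymf_vdm_expand sl suml).
rewrite big_seq [RHS]big_seq; apply: eq_bigr => nu.
by rewrite mem_Parts => /andP[/andP[/eqP sn _] _]; rewrite (KstabE sl sn).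
Qed.

(** [Kstab] shows that [epsilon] selects a solution of [is_Kinv], and coefficient extraction forces
    the value of any solution here. *)
Lemma KinvE m n lam mu : (m <= n)%N -> is_part m n lam -> is_part m n mu ->
  Kinv lam mu = Kdet n lam mu.
Proof.
move=> mn hlam hmu.
have [_ _ /(_ _ _ _ mn hlam)/schur_expansionP e] : is_Kinv Kinv.
  by apply: epsilon_spec; exists Kstab; exact: is_Kinv_Kstab.
case/andP: hlam => /andP[/eqP sl _] _; case/andP: hmu => hmu /eqP sum_mu.
rewrite -mcoeff_msymf_vdm // e mcoeff_sum_altdet // sum_mu.
by rewrite eqxx.
Qed.

(** * Removing parts and leading zeros *)

(** Guarantees that a part [r] with [last 0 mu <= r] is nonzero, hence not one of the padding
    zeros. *)
Lemma part_last_gt0 m n mu : (0 < m)%N -> is_part m n mu -> (0 < last 0 mu)%N.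
Proof.
move=> m0 /andP[hmu /eqP sum_mu]; have /andP[/eqP smu _] := hmu.
rewrite lt0n; apply/eqP => l0; move: m0; rewrite -sum_mu (sumn_nth smu) big1 // => i _.
suff: (nth 0 mu i <= last 0 mu)%N by rewrite l0 leqn0 => /eqP.
rewrite -nth_last smu; apply: (is_tpart_nth hmu).
by have := ltn_ord i; lia.
Qed.

Lemma sumn_rem (lam : seq nat) r : r \in lam -> (r + sumn (rem r lam))%N = sumn lam.
Proof. by move=> /perm_to_rem/perm_sumn ->. Qed.

Lemma is_part_rem m n lam r : is_part m n.+1 lam -> r \in lam ->
  is_part (m - r) n (rem r lam).
Proof.
case/andP => /andP[/eqP sl l_sorted] /eqP suml rl.
rewrite /is_part /is_tpart size_rem // sl eqxx /= -suml -(sumn_rem rl) addKn eqxx andbT.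
exact: subseq_sorted leq_trans _ _ (rem_subseq _ _) l_sorted.
Qed.

Lemma is_tpart_cons0 n w : is_tpart n.+1 (0%N :: w) = is_tpart n w.
Proof.
rewrite /is_tpart eqSS /= (path_sortedE leq_trans); congr (_ && _).
by rewrite andb_idl // => _; apply/allP.
Qed.

Lemma is_part_cons0 m n w : is_part m n.+1 (0%N :: w) = is_part m n w.
Proof. by rewrite /is_part is_tpart_cons0. Qed.

Lemma perm_nzparts_rem (lam : seq nat) r : r != 0%N -> r \in lam ->
  perm_eq (nzparts lam) (r :: nzparts (rem r lam)).
Proof.
move=> r0 rl; rewrite /nzparts (permPl (perm_filter _ (perm_to_rem rl))) /=.
by rewrite r0.
Qed.

Lemma mem_nzparts (lam : seq nat) r : (r \in nzparts lam) = (r != 0%N) && (r \in lam).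
Proof. by rewrite mem_filter. Qed.

(** * Chains *)

(** Splits off the last link, which uses up the part [last 0 mu + j]. The zero put in front of the
    remaining parts keeps the number of entries. *)
Lemma is_chain_rcons n lam mu l c js mu' j :
    size (nzparts lam) = l.+1 -> size c = l.+1 -> size js = l ->
  is_chain n lam mu (rcons c mu', rcons js j) =
  [&& mu' == mu, is_tpart n mu, (last 0 mu + j)%N \in nzparts lam,
      prec j (last [::] c) mu
    & is_chain n (0%N :: rem (last 0 mu + j)%N lam) (last [::] c) (c, js)].
Proof.
move=> sl sc sj; have iE : iota 0 l.+1 = rcons (iota 0 l) l.
  by rewrite -addn1 iotaD cats1.
rewrite /is_chain sl iE [LHS]/= !size_rcons sc sj !eqxx /= all_rcons.
rewrite !nth_rcons sc /= ltnn eqxx.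
case: (eqVneq mu' mu) => [->|]; last by rewrite !andbF.
case: (boolP (is_tpart n mu)) => //= _.
rewrite all_rcons map_rcons !nth_rcons sc sj ltnSn ltnn !eqxx ltnn.
rewrite -(nth_last [::]) sc /=.
have -> : all (fun i => prec (nth 0%N (rcons js j) i) (nth [::] (rcons c mu) i)
                         (nth [::] (rcons c mu) i.+1)) (iota 0 l)
        = all (fun i => prec (nth 0%N js i) (nth [::] c i) (nth [::] c i.+1)) (iota 0 l).
  apply: eq_in_all => i; rewrite mem_iota add0n => /andP[_ il].
  by rewrite !nth_rcons sc sj ltnS (ltnW il) il ltnS il.
have -> : [seq (last 0 (nth [::] (rcons c mu) i.+1) + nth 0 (rcons js j) i)%N | i <- iota 0 l]
        = [seq (last 0 (nth [::] c i.+1) + nth 0 js i)%N | i <- iota 0 l].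
  apply/eq_in_map => i; rewrite mem_iota add0n => /andP[_ il].
  by rewrite !nth_rcons sc sj il ltnS il.
rewrite perm_rcons perm_sym.
case: (boolP (_ \in nzparts lam)) => [|nin]; last first.
  rewrite perm_eq_rem (negPf nin) !andbF //.
rewrite mem_nzparts => /andP[r0 rl].
rewrite (permPl (perm_nzparts_rem r0 rl)) perm_cons perm_sym.
have /perm_size := perm_nzparts_rem r0 rl; rewrite sl /= => -[<-].
by rewrite !eqxx /=; case: (prec j _ mu); rewrite ?andbF.
Qed.

(** The predecessor [b] is compared with [0 :: trunc mu], so its first entry is 0; its tail is the
    [omega] of the recurrence. *)
Lemma precP n j b mu : prec j b mu -> size mu = n.+1 ->
  exists w, [/\ b = 0%N :: w, diff_in j (trunc mu) w
              & sumn (trunc mu) = (sumn w + j)%N].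
Proof.
move=> h /last_trunc[_ st]; case: b h => [|[|y] w] //.
rewrite /prec -/(diff_in j (trunc mu) w) => h; exists w; split=> //.
case/(diff_inP _ _ st): h => sw e <-.
rewrite (sumn_nth st) (sumn_nth sw) -sum1_card [X in (_ + X)%N]big_mkcond.
rewrite -big_split /=; apply: eq_bigr => i _.
by rewrite inE {1}e; case: eqP.
Qed.

Lemma nzparts_nil n lam : size lam = n -> nzparts lam = [::] -> lam = nseq n 0%N.
Proof.
move=> <-; elim: lam => [|[|x] lam IH] //= /IH e.
by congr (_ :: _).
Qed.

Lemma sumn_nzparts a : sumn (nzparts a) = sumn a.
Proof. by elim: a => [|[|x] a IH] //=; rewrite IH. Qed.

Lemma part0 n mu : is_part 0 n mu -> mu = nseq n 0%N.
Proof.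
case/andP => /andP[/eqP <- _] /eqP; elim: mu => [|[|x] mu IH] //= /IH e.
by congr (_ :: _).
Qed.

Lemma Kdet0 n : Kdet n (nseq n 0%N) (nseq n 0%N) = 1.
Proof.
rewrite -[in X in X = _](cats0 (nseq n 0%N)) -{1}[n]addn0 Kdet_nseq /Kdet /altcount.
rewrite (big_pred1 1%g) ?odd_perm1 // => s; rewrite /= /fits.
have -> : enum 'I_0 = [::] by apply: size0nil; rewrite size_enum_ord.
have -> : s = 1%g by apply/permP => -[].
by rewrite eqxx andbT; apply/forallP => -[].
Qed.

Lemma chains0 n lam mu : nzparts lam = [::] -> mu = nseq n 0%N ->
  perm_eq (chains n lam mu) [:: ([:: mu], [::])].
Proof.
move=> nz ->; apply: uniq_perm; rewrite ?chains_uniq // => -[c js].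
rewrite mem_chains /is_chain nz inE /=.
apply/idP/eqP => [|[-> ->]]; last first.
  rewrite /= eqxx /is_tpart size_nseq eqxx !andbT /=; apply/(sortedP 0%N) => i _.
  by rewrite !nth_nseq; do 2 case: ifP.
case: c => [|a [|b c]] //; case: js => //= /and4P[_ _ /eqP -> _].
by [].
Qed.

(** Removing the last link is a bijection from chains to triples: the part [r] used there, the tail
    [w] of the previous partition, and a shorter chain ending at [0 :: w]. *)
Lemma perm_chains_rec n m l lam mu : (0 < m)%N ->
    is_part m n.+1 lam -> is_part m n.+1 mu -> size (nzparts lam) = l.+1 ->
  perm_eq (chains n.+1 lam mu)
    [seq (rcons T.1 mu, rcons T.2 (rw.1 - last 0 mu)%N) |
       rw : nat * seq nat <- [seq (r, w) | r <- [seq r <- undup lam | (last 0 mu <= r)%N],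
               w <- [seq w <- Parts (m - r) n | diff_in (r - last 0 mu)%N (trunc mu) w]],
       T : seq (seq nat) * seq nat <- chains n.+1 (0%N :: rem rw.1 lam) (0%N :: rw.2)].
Proof.
move=> m0 hlam hmu sl; have l0 := part_last_gt0 m0 hmu.
have /andP[/andP[/eqP smu mu_sorted] /eqP sum_mu] := hmu.
have [muE st] := last_trunc smu.
have sum_t : m = (sumn (trunc mu) + last 0 mu)%N by rewrite -sum_mu {1}muE sumn_rcons.
have chain_sizes r w c js : r \in lam -> (last 0 mu <= r)%N ->
    is_chain n.+1 (0%N :: rem r lam) (0%N :: w) (c, js) ->
  [/\ size c = l.+1, size js = l & last [::] c = 0%N :: w].
  move=> rl lr; have r0 : r != 0%N by lia.
  have /perm_size := perm_nzparts_rem r0 rl; rewrite sl /= => -[e].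
  case/and5P => /eqP; rewrite /= -e => sc /eqP sj _ _ /andP[/eqP lc _]; split=> //.
  by rewrite -nth_last sc.
apply: uniq_perm; first exact: chains_uniq.
  apply: allpairs_uniq_dep.
  - apply: allpairs_uniq_dep.
    + by rewrite filter_uniq ?undup_uniq.
    + by move=> r _; rewrite filter_uniq ?Parts_uniq.
    + by move=> [r w] [r' w'] _ _ /= [-> ->].
  - by move=> rw _; exact: chains_uniq.
  (* Injectivity: [w] is read off the end of the shorter chain, and [r] off the last index, because
     [last 0 mu <= r]. *)
  move=> [[r w] [c js]] [[r' w'] [c' js']] /=.
  case/allpairsPdep => -[x y] [S [/allpairsPdep[r1 [w1 [+ _ [-> ->]]]] + [-> -> eS]]].
  move: eS => /= eS; rewrite -eS mem_filter mem_undup mem_chains /= => /andP[lr rl] hS.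
  case/allpairsPdep => -[x' y'] [S' [/allpairsPdep[r2 [w2 [+ _ [-> ->]]]] + [-> -> eS']]].
  move: eS' => /= eS'; rewrite -eS' mem_filter mem_undup mem_chains /= => /andP[lr' rl'] hS'.
  case=> /rcons_inj[ec] /rcons_inj[ej er].
  have [_ _ h] := chain_sizes _ _ _ _ rl lr hS.
  have [_ _ h'] := chain_sizes _ _ _ _ rl' lr' hS'.
  move: h'; rewrite -ec h => -[<-]; rewrite ec ej.
  by have -> : r1 = r2 by lia.
move=> [C J]; rewrite mem_chains; apply/idP/allpairsPdep => [hC|].
  have [sC sJ] : size C = l.+2 /\ size J = l.+1.
    by case/and3P: (hC) => /eqP + /eqP; rewrite /= sl.
  case/lastP: C sC hC => // c mu'; case/lastP: J sJ => // js j.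
  rewrite !size_rcons => -[sj] -[sc].
  rewrite (is_chain_rcons _ _ _ _ sl sc sj) => /and5P[/eqP -> _ r_in hp hc].
  have [w [bE dw sum_w]] := precP hp smu.
  move: r_in; rewrite mem_nzparts => /andP[r0 rl].
  exists ((last 0 mu + j)%N, w); exists (c, js); split.
  - apply/allpairsPdep; exists (last 0 mu + j)%N; exists w; split=> //.
      by rewrite mem_filter mem_undup rl leq_addr.
    rewrite mem_filter addKn dw mem_Parts /= /is_part.
    have -> : (sumn w == m - (last 0 mu + j))%N by lia.
    rewrite andbT -is_tpart_cons0 -bE.
    case/and3P: hc => _ _ /andP[/allP h _]; apply: h => /=.
    by case: (c) sc => //= a c' _; exact: mem_last.
  - by rewrite mem_chains -bE.
  by rewrite addKn.
case=> -[r w] [[c js] [/allpairsPdep[r1 [w1 [+ + [-> ->]]]]]].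
rewrite mem_chains !mem_filter mem_undup /= => /andP[lr rl] /andP[dw _] hS [-> ->].
have [sc sj lc] := chain_sizes _ _ _ _ rl lr hS.
rewrite (is_chain_rcons _ _ _ _ sl sc sj) eqxx subnKC // mem_nzparts rl lc hS.
rewrite /is_tpart smu eqxx mu_sorted /=.
by rewrite !andbT; apply/andP; split; [lia | exact: dw].
Qed.

(** Induction on the number of nonzero parts with [n] fixed: both sides obey the same recurrence. *)
Lemma Kdet_chains n m lam mu : is_part m n lam -> is_part m n mu ->
  Kdet n lam mu = \sum_(S <- chains n lam mu) (-1) ^+ sumn S.2.
Proof.
move: {2}(size (nzparts lam)) (erefl (size (nzparts lam))) => l.
elim: l m lam mu => [|l IH] m lam mu sl hlam hmu.
  have nz := size0nil sl; have /andP[/andP[/eqP slam _] /eqP suml] := hlam.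
  have m0 : m = 0%N by rewrite -suml -sumn_nzparts nz.
  rewrite m0 in hmu; have muE := part0 hmu.
  rewrite (perm_big _ (chains0 nz muE)) big_seq1 /= muE (nzparts_nil slam nz).
  exact: Kdet0.
have /andP[/andP[/eqP slam _] /eqP suml] := hlam.
have m0 : (0 < m)%N.
  rewrite -suml -sumn_nzparts; case E : (nzparts lam) sl => [|x s] //= _.
  have : x \in nzparts lam by rewrite E mem_head.
  by rewrite mem_nzparts; lia.
case: n IH hlam hmu slam => [|n] IH hlam hmu slam; first by rewrite (size0nil slam) in sl.
have l0 := part_last_gt0 m0 hmu.
rewrite (perm_big _ (perm_chains_rec m0 hlam hmu sl)) big_allpairs_dep /=.
rewrite big_allpairs_dep /= (Kdet_rec hmu suml) -[LHS]big_filter.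
rewrite [LHS]big_seq [RHS]big_seq; apply: eq_bigr => r.
rewrite mem_filter mem_undup => /andP[lr rl].
rewrite mulr_sumr -[LHS]big_filter [LHS]big_seq [RHS]big_seq; apply: eq_bigr => w.
rewrite mem_filter mem_Parts => /andP[_ hw].
(* A leading zero brings the smaller partitions back to [n.+1] entries, as the induction hypothesis
   requires. *)
rewrite -Kdet_cons0 (IH (m - r)%N).
- by rewrite mulr_sumr; apply: eq_bigr => S _; rewrite sumn_rcons exprD mulrC.
- have r0 : r != 0%N by lia.
  by have /perm_size := perm_nzparts_rem r0 rl; rewrite sl /= => -[].
- by rewrite is_part_cons0 is_part_rem.
by rewrite is_part_cons0.
Qed.

Lemma mem_exp_part n k (r i : 'I_k -> nat) x :
    (forall s, (1 <= i s)%N) -> (0 < x)%N ->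
  (x \in exp_part n r i) = [exists s, x == r s].
Proof.
move=> i_ge1 x0; rewrite /exp_part mem_cat mem_nseq (gtn_eqF x0) andbF /=.
apply/flatten_mapP/existsP => [[s _]|[s /eqP ->]].
  by rewrite mem_nseq => /andP[_ xr]; exists s.
by exists s; rewrite ?mem_enum // mem_nseq i_ge1 eqxx.
Qed.

Theorem theorem3 (m n k : nat) (r i : 'I_k -> nat) (lam mu : seq nat)
  (m_ge1 : (1 <= m)%N) (m_le_n : (m <= n)%N)
  (r_ge1 : forall s, (1 <= r s)%N)
  (r_incr : forall s t : 'I_k, (s < t)%N -> (r s < r t)%N)
  (i_ge1 : forall s, (1 <= i s)%N)
  (lam_def : lam = exp_part n r i)
  (lam_part : is_part m n lam) (mu_part : is_part m n mu) :
  Kinv lam mu =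
    \sum_(j < k | (last 0 mu <= r j)%N)
      (-1) ^+ (r j - last 0 mu)%N *
      \sum_(w <- Parts (m - r j) n.-1 | diff_in (r j - last 0 mu)%N (trunc mu) w)
        Kinv (rem (r j) lam) w
  /\
  Kinv lam mu = \sum_(S <- chains n lam mu) (-1) ^+ sumn S.2.
Proof.
rewrite (KinvE m_le_n lam_part mu_part); split; last exact: Kdet_chains lam_part mu_part.
have l0 := part_last_gt0 m_ge1 mu_part.
have r_inj : injective r.
  move=> s t e; apply: ord_inj; have := r_incr s t; have := r_incr t s; lia.
have mem_lam x : (0 < x)%N -> (x \in lam) = [exists s, x == r s].
  by rewrite lam_def; exact: mem_exp_part.
have r_in s : r s \in lam by rewrite mem_lam //; apply/existsP; exists s.
case: n m_le_n lam_def lam_part mu_part => [|n] m_le_n lam_def lam_part mu_part /=; first lia.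
transitivity (\sum_(j < k | (last 0 mu <= r j)%N)
      (-1) ^+ (r j - last 0 mu)%N *
      \sum_(w <- Parts (m - r j) n | diff_in (r j - last 0 mu)%N (trunc mu) w)
        Kdet n (rem (r j) lam) w); last first.
  (* [KinvE] applies with [n] variables because [r j >= 1] gives [m - r j <= n]. *)
  apply: eq_bigr => j _; congr (_ * _); rewrite big_seq_cond [RHS]big_seq_cond.
  apply: eq_bigr => w; rewrite mem_Parts => /andP[hw _].
  rewrite (KinvE _ _ hw) ?is_part_rem //.
  by have := r_ge1 j; lia.
have /andP[_ /eqP suml] := lam_part.
(* By injectivity of [r] the sum over indices becomes a sum over values, to be compared with the
   distinct parts of [lam]. *)
rewrite (Kdet_rec mu_part suml) -(big_map r (fun x => last 0 mu <= x)%N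
  (fun x => (-1) ^+ (x - last 0 mu)%N *
     \sum_(w <- Parts (m - x) n | diff_in (x - last 0 mu)%N (trunc mu) w)
        Kdet n (rem x lam) w)).
rewrite -[LHS]big_filter -[RHS]big_filter; apply: perm_big; apply: uniq_perm.
- by rewrite filter_uniq ?undup_uniq.
- by rewrite filter_uniq ?map_inj_uniq ?index_enum_uniq.
move=> x; rewrite !mem_filter mem_undup; case: leqP => //= lx.
rewrite mem_lam; last by lia.
apply/existsP/mapP => [[s /eqP ->]|[s _ ->]]; last by exists s.
by exists s; rewrite ?mem_index_enum.
Qed.
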